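(* Let $P$ and $Q$ be probability measures on $\mathbb R$ such that $(P,Q)\in\mathcal H$. Then $P\leq_{\mathrm{st}}Q$.
   Context: Stochastic order: for probability measures $P,Q$ on $\mathbb R$, $P\leq_{\mathrm{st}}Q$ means $P([x,\infty))\leq Q([x,\infty))$ for all $x\in\mathbb R$. Likelihood ratio: for probability measures $P,Q$ on $\mathbb R$ let $f=\frac{\mathrm dP}{\mathrm d(P+Q)}$ and $g=\frac{\mathrm dQ}{\mathrm d(P+Q)}$. A version of the likelihood ratio is a function $\ell:\mathbb R\to[0,\infty]$ with $\ell=f/g$ $(P+Q)$-almost everywhere, with the convention $c/0=\infty$ for $c>0$. $\mathcal H$ is the set of pairs $(P,Q)$ of probability measures on $\mathbb R$ for which there exists a version $\ell$ of the likelihood ratio with the following properties: (i) there exists $x_0\in\mathbb R$ such that $\ell$ is monotone (increasing or decreasing) on $(-\infty,x_0]$ and monotone (increasing or decreasing) on $[x_0,\infty)$; (ii) $\lim_{x\to-\infty}\ell(x)\geq1$ and $\lim_{x\to\infty}\ell(x)\leq1$. Monotonicity is meant in the weak sense. *)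

(* Defs.v *)
From HB Require Import structures.
From mathcomp Require Import all_boot all_order all_algebra.
From mathcomp Require Import all_classical all_reals all_analysis.

Set Implicit Arguments.
Unset Strict Implicit.
Unset Printing Implicit Defensive.

Import Order.TTheory GRing.Theory Num.Theory.
Import numFieldNormedType.Exports.

Local Open Scope classical_set_scope.
Local Open Scope ring_scope.
Local Open Scope ereal_scope.
Local Open Scope charge_scope.

(* The library has no finiteness instance for [measure_add], which the
   Radon-Nikodym derivative with respect to [measure_add P Q] requires. *)
Section measure_add_finite.
Context d (T : measurableType d) (R : realType).
Variables P Q : {finite_measure set T -> \bar R}.

Let measure_add_fin : fin_num_fun (measure_add P Q).
Proof.
by move=> A mA; rewrite measure_addE fin_numD !fin_num_measure.
Qed.

HB.instance Definition _ := Measure.copy (measure_add P Q)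
  (msum (fun n => if n is 0%N then P : {measure set T -> \bar R} else Q) 2).

HB.instance Definition _ :=
  @Measure_isFinite.Build _ _ _ (measure_add P Q) measure_add_fin.

End measure_add_finite.

Section definitions.
Context {R : realType}.
Implicit Types P Q : probability R R.

Definition le_st P Q : Prop := forall x : R, P `[x, +oo[%classic <= Q `[x, +oo[%classic.

Definition density_fst P Q : R -> \bar R :=
  'd (charge_of_finite_measure P) '/d (measure_add P Q).

Definition density_snd P Q : R -> \bar R :=
  'd (charge_of_finite_measure Q) '/d (measure_add P Q).

(* Division in [\bar R] satisfies 0^-1 = +oo, hence c / 0 = +oo for c > 0. *)
Definition lr_version P Q (l : R -> \bar R) : Prop :=
  (forall x, 0 <= l x) /\
  {ae measure_add P Q, forall x, l x = density_fst P Q x / density_snd P Q x}.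

Definition monotone_on (I : interval R) (l : R -> \bar R) : Prop :=
  {in I &, {homo l : x y / (x <= y)%R >-> x <= y}} \/
  {in I &, {homo l : x y / (x <= y)%R >-> y <= x}}.

Definition calH : set (probability R R * probability R R) :=
  [set PQ | exists l : R -> \bar R,
    [/\ lr_version PQ.1 PQ.2 l,
        exists x0 : R, monotone_on `]-oo, x0] l /\ monotone_on `[x0, +oo[ l,
        exists2 a, l x @[x --> -oo%R] --> a & 1 <= a
      & exists2 b, l x @[x --> +oo%R] --> b & b <= 1]].

(* The derivatives above are genuine: outside absolute continuity the library
   gives ['d _ '/d _] the junk value [-oo]. *)
Lemma dominates_add_fst P Q :
  charge_of_finite_measure P `<< measure_add P Q.
Proof.
apply/null_content_dominatesP => A mA /=; rewrite measure_addE => /eqP.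
by rewrite padde_eq0 ?measure_ge0// => /andP[/eqP].
Qed.

Lemma dominates_add_snd P Q :
  charge_of_finite_measure Q `<< measure_add P Q.
Proof.
apply/null_content_dominatesP => A mA /=; rewrite measure_addE => /eqP.
by rewrite padde_eq0 ?measure_ge0// => /andP[_ /eqP].
Qed.

End definitions.

Arguments calH R : clear implicits.
Arguments dominates_add_fst {R} P Q.
Arguments dominates_add_snd {R} P Q.

(* Main.v *)
(* Write l for the version of dP/dQ given by membership in calH.  A value of l
   below 1 is never followed by a value above 1: if l y < 1, the limit at -oo
   forbids l to increase on a left piece containing y; if l z > 1, the limit at
   +oo forbids l to increase on a right piece containing z; in the remaining
   cases l decreases from y to z.  So for each x either l <= 1 on [x, +oo[ or
   l >= 1 on ]-oo, x[, and comparing densities there yields the inequality, in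
   the second case after passing to complements. *)
Require Import Defs.
From HB Require Import structures.
From mathcomp Require Import all_boot all_order all_algebra.
From mathcomp Require Import all_classical all_reals all_analysis.
From mathcomp Require Import measurable_realfun.

Set Implicit Arguments.
Unset Strict Implicit.
Unset Printing Implicit Defensive.

Import Order.TTheory GRing.Theory Num.Theory.
Import numFieldNormedType.Exports.

Local Open Scope classical_set_scope.
Local Open Scope ring_scope.
Local Open Scope ereal_scope.
Local Open Scope charge_scope.

Lemma fin_num_div_ge1 (R : realType) (x y : \bar R) :
  x \is a fin_num -> y \is a fin_num -> 0 <= x -> 0 <= y ->
  1 <= x / y -> y <= x.
Proof.
case: x y => [x| |] [y| |]// _ _; rewrite !lee_fin inver => x0 y0.
have [->|yn0] := eqVneq y 0%R; first by [].
by rewrite -EFinM !lee_fin ler_pdivlMr ?mul1r// lt_neqAle eq_sym yn0.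
Qed.

Lemma fin_num_div_le1 (R : realType) (x y : \bar R) :
  x \is a fin_num -> y \is a fin_num -> 0 <= x -> 0 <= y ->
  x / y <= 1 -> x <= y.
Proof.
case: x y => [x| |] [y| |]// _ _; rewrite !lee_fin inver => x0 y0.
(* With a zero denominator, [x > 0] makes the quotient [+oo], contradicting the bound, while for
   [x = 0] both sides of the conclusion vanish. *)
have [->|yn0] := eqVneq y 0%R.
  have [->//|xn0] := eqVneq x 0%R.
  by rewrite gt0_muley// lte_fin lt_neqAle eq_sym xn0.
by rewrite -EFinM !lee_fin ler_pdivrMr ?mul1r// lt_neqAle eq_sym yn0.
Qed.

Section Radon_Nikodym_order.
Context d (T : measurableType d) (R : realType).
Variable mu : {sigma_finite_measure set T -> \bar R}.
Implicit Types nu : {finite_measure set T -> \bar R}.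

(** The derivative is taken of [nu] viewed as a charge, so its sign is known only through its almost
    everywhere equality with the nonnegative density [Radon_Nikodym_SigmaFinite.f]. *)
Lemma ae_ge0_Radon_Nikodym nu : nu `<< mu ->
  {ae mu, forall x, 0 <= ('d (charge_of_finite_measure nu) '/d mu) x}.
Proof.
move=> numu; have := ae_eq_Radon_Nikodym_SigmaFinite numu measurableT.
apply: filterS => x /(_ I) <-.
exact: Radon_Nikodym_SigmaFinite.f_ge0.
Qed.

(** Both measures are integrals over [A] of their densities [Radon_Nikodym_SigmaFinite.f]. These are
    nonnegative everywhere, so the almost everywhere comparison can be integrated. *)
Lemma le_measure_Radon_Nikodym nu1 nu2 (A : set T) :
  nu1 `<< mu -> nu2 `<< mu -> measurable A ->
  {ae mu, forall x, A x ->
    ('d (charge_of_finite_measure nu1) '/d mu) x <=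
    ('d (charge_of_finite_measure nu2) '/d mu) x} ->
  nu1 A <= nu2 A.
Proof.
move=> mu1 mu2 mA le12.
have mRN nu : nu `<< mu ->
    measurable_fun A (Radon_Nikodym_SigmaFinite.f nu mu).
  move=> numu; apply: measurable_funTS; apply: (measurable_int mu).
  exact: Radon_Nikodym_SigmaFinite.f_integrable.
rewrite (Radon_Nikodym_SigmaFinite.f_integral mu1 mA).
rewrite (Radon_Nikodym_SigmaFinite.f_integral mu2 mA).
apply: ae_ge0_le_integral => //.
- by move=> x _; exact: Radon_Nikodym_SigmaFinite.f_ge0.
- exact: mRN.
- by move=> x _; exact: Radon_Nikodym_SigmaFinite.f_ge0.
- exact: mRN.
have e1 := ae_eq_Radon_Nikodym_SigmaFinite mu1 mA.
have e2 := ae_eq_Radon_Nikodym_SigmaFinite mu2 mA.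
apply: filterS3 le12 e1 e2 => x le12 e1 e2 Ax.
by rewrite e1// e2//; exact: le12.
Qed.

End Radon_Nikodym_order.

Section likelihood_ratio.
Context {R : realType}.
Variables P Q : probability R R.

(** Almost everywhere the two densities are finite and nonnegative, so a ratio at most 1 can be
    cleared of its denominator and the result integrated over [A]. *)
Lemma lr_version_le1 (l : R -> \bar R) (A : set R) : lr_version P Q l ->
  measurable A -> (forall x, A x -> l x <= 1) -> P A <= Q A.
Proof.
move=> [_ lE] mA l1.
apply: (le_measure_Radon_Nikodym (dominates_add_fst P Q)
  (dominates_add_snd P Q) mA).
have P0 := ae_ge0_Radon_Nikodym (dominates_add_fst P Q).
have Q0 := ae_ge0_Radon_Nikodym (dominates_add_snd P Q).
apply: filterS3 lE P0 Q0 => x lE P0 Q0 Ax.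
apply: fin_num_div_le1 => //; last by rewrite -lE; exact: l1.
  exact/Radon_Nikodym_fin_num/dominates_add_fst.
exact/Radon_Nikodym_fin_num/dominates_add_snd.
Qed.

Lemma lr_version_ge1 (l : R -> \bar R) (A : set R) : lr_version P Q l ->
  measurable A -> (forall x, A x -> 1 <= l x) -> Q A <= P A.
Proof.
move=> [_ lE] mA l1.
apply: (le_measure_Radon_Nikodym (dominates_add_snd P Q)
  (dominates_add_fst P Q) mA).
have P0 := ae_ge0_Radon_Nikodym (dominates_add_fst P Q).
have Q0 := ae_ge0_Radon_Nikodym (dominates_add_snd P Q).
apply: filterS3 lE P0 Q0 => x lE P0 Q0 Ax.
apply: fin_num_div_ge1 => //; last by rewrite -lE; exact: l1.
  exact/Radon_Nikodym_fin_num/dominates_add_fst.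
exact/Radon_Nikodym_fin_num/dominates_add_snd.
Qed.

End likelihood_ratio.

Section single_crossing.
Context {R : realType}.
Variables (l : R -> \bar R) (x0 : R).

Lemma ge_ninfty_lim_nondecreasing (a : \bar R) :
  {in `]-oo, x0] &, {homo l : x y / (x <= y)%R >-> x <= y}} ->
  l x @[x --> -oo%R] --> a -> forall y, (y <= x0)%R -> a <= l y.
Proof.
move=> ndl la y yx0; apply: (cvge_le _ la).
have := @nbhs_ninfty_le R y (num_real y).
apply: filterS => t ty; apply: ndl => //; rewrite in_itv//=.
exact: le_trans yx0.
Qed.

Lemma le_pinfty_lim_nondecreasing (b : \bar R) :
  {in `[x0, +oo[ &, {homo l : x y / (x <= y)%R >-> x <= y}} ->
  l x @[x --> +oo%R] --> b -> forall y, (x0 <= y)%R -> l y <= b.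
Proof.
move=> ndl lb y x0y; apply: (cvge_ge _ lb).
have := @nbhs_pinfty_ge R y (num_real y).
apply: filterS => t yt; apply: ndl => //; rewrite in_itv//= andbT//.
exact: le_trans yt.
Qed.

Lemma single_crossing_at1 (a b : \bar R) :
  monotone_on `]-oo, x0] l -> monotone_on `[x0, +oo[ l ->
  l x @[x --> -oo%R] --> a -> 1 <= a -> l x @[x --> +oo%R] --> b -> b <= 1 ->
  forall y z : R, (y <= z)%R -> l y < 1 -> l z <= 1.
Proof.
move=> monL monR la a1 lb b1 y z yz ly1.
(* The bound is by [l u] rather than by 1, so that strict inequality survives up to [x0]. *)
have niL (u v : R) : (u <= v)%R -> (v <= x0)%R -> l u < 1 -> l v <= l u.
  move=> uv vx0 lu1; have ux0 := le_trans uv vx0.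
  case: monL => [nd|ni]; last by apply: ni; rewrite ?in_itv.
  have := ge_ninfty_lim_nondecreasing nd la ux0.
  by move=> /(le_trans a1); rewrite leNgt lu1.
have leR (u v : R) : (u <= v)%R -> (x0 <= u)%R -> l u < 1 -> l v <= 1.
  move=> uv x0u lu1; have x0v := le_trans x0u uv.
  case: monR => [nd|ni].
    exact: le_trans (le_pinfty_lim_nondecreasing nd lb x0v) b1.
  by apply: (le_trans _ (ltW lu1)); apply: ni; rewrite ?in_itv/= ?andbT.
have [x0y|/ltW yx0] := leP x0 y; first exact: leR ly1.
have [zx0|/ltW x0z] := leP z x0.
  exact: le_trans (niL _ _ yz zx0 ly1) (ltW ly1).
(* Here [x0] lies between [y] and [z] and belongs to both pieces: [l x0 <= l y < 1] from the left
   piece restarts the argument on the right one. *)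
apply: (leR x0) => //; exact: le_lt_trans (niL _ _ yx0 (lexx _) ly1) ly1.
Qed.

End single_crossing.

Theorem proposition2p3 (R : realType) (P Q : probability R R)
  (hPQ : (P, Q) \in calH R) : le_st P Q.
Proof.
move: hPQ; rewrite inE => -[l [/= lv [x0 [monL monR]] [a la a1] [b lb b1]]] x.
have [l1|] := pselect (forall z, (x <= z)%R -> l z <= 1).
  apply: (lr_version_le1 lv) => // z /=.
  by rewrite in_itv/= andbT; exact: l1.
move=> /existsNP[z /not_implyP[xz /negP lz1]].
(* A point [y < x] with [l y < 1] would force [l z <= 1] at the chosen [z], where [l] exceeds 1. *)
have QP : Q `]-oo, x[%classic <= P `]-oo, x[%classic.
  apply: (lr_version_ge1 lv) => // y /=; rewrite in_itv/= => yx.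
  rewrite leNgt; apply: contra lz1 => ly1.
  apply: (single_crossing_at1 monL monR la a1 lb b1) ly1.
  exact: le_trans (ltW yx) xz.
by rewrite -setCitvl !probability_setC// leeB.
Qed.
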